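(* Let $X$ be a topological space and let $Y \subseteq X$ be a subset with the subspace topology. Then $Y$ is $B_1^*$-embedded in $X$ if and only if any pair of subsets of $Y$ which are completely separated in $Y$ by $B_1(Y)$ are also completely separated in $X$ by $B_1(X)$.
   Context: For a topological space $X$, $B_1(X)$ denotes the set of all Baire one functions on $X$, i.e. functions $f : X \to \mathbb{R}$ for which there is a sequence $\{f_n\}$ of continuous functions $f_n : X \to \mathbb{R}$ converging pointwise to $f$ on $X$. $B_1^*(X)$ denotes the set of bounded functions in $B_1(X)$. A subset $Y$ of $X$ is $B_1^*$-embedded in $X$ if for each $f \in B_1^*(Y)$ there is $g \in B_1^*(X)$ with $g|_Y = f$. Two subsets $A, B$ of $X$ are completely separated in $X$ by $B_1(X)$ if there exist $f \in B_1^*(X)$ and reals $r < s$ such that $f(x) = r$ for all $x \in A$, $f(x) = s$ for all $x \in B$, and $r \le f(x) \le s$ for all $x \in X$. *)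

(* Defs.v *)
From HB Require Import structures.
From mathcomp Require Import all_boot all_order all_algebra.
From mathcomp Require Import all_classical all_reals all_analysis.

Set Implicit Arguments.
Unset Strict Implicit.
Unset Printing Implicit Defensive.

Import Order.TTheory GRing.Theory Num.Theory.
Import numFieldNormedType.Exports.

Local Open Scope classical_set_scope.
Local Open Scope ring_scope.

Section BaireOne.
Variables (R : realType) (X : topologicalType).

Definition baire_one : set (X -> R) :=
  [set f | exists f_ : nat -> X -> R,
    (forall n, continuous (f_ n)) /\
    (forall x, f_ n x @[n --> \oo] --> f x)].

Definition bounded_baire_one : set (X -> R) := baire_one `&` bounded_fun.

Definition B1_completely_separated (A B : set X) : Prop :=
  exists f : X -> R, exists r s : R,
    [/\ bounded_baire_one f, r < s,
        forall x, A x -> f x = r,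
        forall x, B x -> f x = s &
        forall x, r <= f x <= s].

End BaireOne.

Arguments baire_one : clear implicits.
Arguments bounded_baire_one : clear implicits.
Arguments B1_completely_separated R {X} A B.

(* [set_type Y], to which [Y] coerces, is the subtype of points of [Y], with the
   initial topology of [set_val], i.e. the subspace topology (unlike
   [subspace Y], whose carrier is all of [X]). *)
Definition B1star_embedded (R : realType) (X : topologicalType) (Y : set X) :
    Prop :=
  forall f : Y -> R, bounded_baire_one R (set_type Y) f ->
    exists2 g : X -> R, bounded_baire_one R X g & g \o set_val = f.

Arguments B1star_embedded R {X} Y.

(* Main.v *)
(* The extension is built as in Tietze's theorem.  If |f| <= r on Y, then
   {f <= -r/3} and {r/3 <= f} are separated in Y by a truncation of f, hence
   they are separated in X, and this yields a Baire one g on X with |g| <= r/3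
   and |f - g| <= 2r/3 on Y.  Iterating on f - g gives a series of Baire one
   functions, dominated by a geometric series, whose sum extends f.  The sum is
   Baire one: if the approximants g_(n,k) of g_n are truncated to the bound of
   g_n, then by dominated convergence for series the continuous functions
   \sum_(n < k) g_(n,k) converge pointwise to the sum of the g_n. *)
Require Import Defs.
From mathcomp Require Import all_boot all_order all_algebra.
From mathcomp Require Import all_classical all_reals all_analysis.
From mathcomp Require Import lra.

Local Open Scope classical_set_scope.

Section BaireOneTheory.
Import Order.TTheory GRing.Theory Num.Theory.
Import numFieldNormedType.Exports.
Local Open Scope ring_scope.

Context {R : realType}.

(** Composing with this continuous truncation imposes bounds on approximants, separating functions
    and extensions without leaving the first Baire class. *)
Definition clip (a b t : R) : R := Num.max a (Num.min b t).

Lemma clip_itv (a b t : R) : a <= b -> a <= clip a b t <= b.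
Proof. by move=> ab; rewrite /clip le_max lexx ge_max ab ge_min lexx. Qed.

Lemma clip_norm (c t : R) : 0 <= c -> `|clip (- c) c t| <= c.
Proof. by move=> c0; rewrite ler_norml clip_itv// ge0_cp. Qed.

Lemma clip_id (a b t : R) : a <= t <= b -> clip a b t = t.
Proof. by move=> /andP[at_ tb]; rewrite /clip min_r// max_r. Qed.

Lemma clip_le (a b t : R) : a <= b -> t <= a -> clip a b t = a.
Proof. by move=> ab ta; rewrite /clip max_l// ge_min ta orbT. Qed.

Lemma clip_ge (a b t : R) : a <= b -> b <= t -> clip a b t = b.
Proof. by move=> ab bt; rewrite /clip min_l// max_r. Qed.

Lemma continuous_clip (a b : R) : continuous (clip a b).
Proof.
move=> t; apply: (@continuous_max R R (cst a) (fun t => Num.min b t)).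
  exact: cvg_cst.
apply: (@continuous_min R R (cst b) id).
  exact: cvg_cst.
exact: cvg_id.
Qed.

Lemma bounded_funE (T : Type) (f : T -> R) :
  bounded_fun f <-> exists M, forall x, `|f x| <= M.
Proof.
split=> [[M [_ Mf]]|[M Mf]].
  by exists (M + 1) => x; apply: Mf => //; rewrite ltrDl.
exists M; split; first exact: num_real.
by move=> N MN x _ /=; exact: le_trans (ltW MN).
Qed.

Section BaireOneOn.
Context {X : topologicalType}.
Implicit Types f g : X -> R.

Lemma baire_one_comp (phi : R -> R) f :
  continuous phi -> baire_one R X f -> baire_one R X (phi \o f).
Proof.
move=> cphi [f_ [cf f_f]]; exists (fun n => phi \o f_ n); split.
  by move=> n x; apply: continuous_comp; [exact: cf|exact: cphi].
by move=> x; apply: continuous_cvg; [exact: cphi|exact: f_f].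
Qed.

Lemma baire_oneB f g :
  baire_one R X f -> baire_one R X g -> baire_one R X (f \- g).
Proof.
move=> [f_ [cf f_f]] [g_ [cg g_g]]; exists (fun n => f_ n \- g_ n); split.
  by move=> n x; apply: (@continuousB R R); [exact: cf|exact: cg].
by move=> x; apply: cvgB; [exact: f_f|exact: g_g].
Qed.

Lemma baire_one_pullback {Z : topologicalType} (h : Z -> X) f :
  continuous h -> baire_one R X f -> baire_one R Z (f \o h).
Proof.
move=> ch [f_ [cf f_f]]; exists (fun n => f_ n \o h); split.
  by move=> n x; apply: continuous_comp; [exact: ch|exact: cf].
by move=> x; exact: f_f.
Qed.

(* Truncating the approximants of [f] does not change their limit. *)
Lemma baire_one_bounded_approx (c : R) f :
  0 <= c -> (forall x, `|f x| <= c) -> baire_one R X f ->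
  exists f_ : nat -> X -> R, [/\ forall n, continuous (f_ n),
    forall n x, `|f_ n x| <= c & forall x, f_ n x @[n --> \oo] --> f x].
Proof.
move=> c0 fc [f_ [cf f_f]]; exists (fun n => clip (- c) c \o f_ n); split.
- move=> n x; apply: continuous_comp; first exact: cf.
  exact: continuous_clip.
- by move=> n x; exact: clip_norm.
- move=> x; rewrite -[f x](@clip_id (- c) c) -?ler_norml//.
  by apply: continuous_cvg; [exact: continuous_clip|exact: f_f].
Qed.

End BaireOneOn.

(** Dominated convergence in diagonal form: the number of terms grows with the index [k]. Cut at a
    fixed [N]: the head is a finite sum of convergent sequences, and the tail is dominated by that
    of [c], uniformly in [k]. *)
Lemma tannery (u : nat -> nat -> R) (v c : nat -> R) (l : R) :
  (forall n k, `|u n k| <= c n) -> (forall n, u n k @[k --> \oo] --> v n) ->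
  cvgn (series c) -> series v @ \oo --> l ->
  \sum_(0 <= n < k) u n k @[k --> \oo] --> l.
Proof.
move=> uc uv cc vl; apply/cvgrPdist_le => e e0.
have e3 : 0 < e / 3 by rewrite divr_gt0.
(* One third of [e] goes to the tail of [v], one to the tail of [c], and the last to the head of
   [u]. *)
have [N [vN cN]] : exists N,
    `|l - series v N| <= e / 3 /\ `|limn (series c) - series c N| <= e / 3.
  have /cvgrPdist_le/(_ _ e3)[N1 _ H1] := vl.
  have /cvgrPdist_le/(_ _ e3)[N2 _ H2] := cc.
  exists (maxn N1 N2); split; first by apply: H1; exact: leq_maxl.
  by apply: H2; exact: leq_maxr.
have uN : \sum_(0 <= n < N) u n k @[k --> \oo] --> series v N.
  by apply: cvg_big => //; exact: add_continuous.
have /cvgrPdist_le/(_ _ e3)[K _ HK] := uN.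
exists (maxn N K) => // k /=; rewrite geq_max => /andP[Nk Kk].
have {HK} := HK k Kk; rewrite /= => HK.
have c0 n : 0 <= c n by exact: le_trans (uc n 0%N).
have tail : `|\sum_(N <= n < k) u n k| <= e / 3.
  apply: le_trans cN; apply: (le_trans (ler_norm_sum _ _ _)).
  apply: (@le_trans _ _ (\sum_(N <= n < k) c n)); first exact: ler_sum.
  have := sub_series c N k; rewrite Nk => <-.
  apply: le_trans (ler_norm _); rewrite lerB//.
  by apply: nondecreasing_cvgn_le => //; exact: nondecreasing_series.
rewrite (@big_cat_nat _ _ _ N)//=.
move: HK tail vN; rewrite !ler_norml; lra.
Qed.

Lemma baire_one_series {X : topologicalType} (g : nat -> X -> R)
    (c : nat -> R) :
  (forall n, baire_one R X (g n)) -> (forall n x, `|g n x| <= c n) ->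
  cvgn (series c) -> baire_one R X (fun x => limn (series (g ^~ x))).
Proof.
move=> bg gc cc.
(* A point of [X] is what gives [0 <= c n], required for truncating at [c n]; on an empty space any
   sequence of functions works. *)
have [x0|X0] := pselect (exists x : X, True); last first.
  exists (fun _ _ => 0); split=> [n x|x]; first by exfalso; apply: X0; exists x.
  by exfalso; apply: X0; exists x.
have c0 n : 0 <= c n by case: x0 => x _; exact: le_trans (gc n x).
have /choice[u uP] := fun n =>
  baire_one_bounded_approx _ _ (c0 n) (gc n) (bg n).
exists (fun k x => \sum_(0 <= n < k) u n k x); split.
  move=> k; apply: continuous_big => [|n _]; first exact: add_continuous.
  by have [cu _ _] := uP n; exact: cu.
move=> x; apply: (tannery (fun n k => u n k x) (g ^~ x) c) => //.
- by move=> n k; have [_ uc _] := uP n; exact: uc.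
- by move=> n; have [_ _ uv] := uP n; exact: uv.
- by apply: normed_cvg; apply: series_le_cvg cc => n /=.
Qed.

Lemma bounded_baire_one_clip {X : topologicalType} (a b : R) (f : X -> R) :
  a <= b -> baire_one R X f -> bounded_baire_one R X (clip a b \o f).
Proof.
move=> ab bf; split.
  by apply: baire_one_comp => //; exact: continuous_clip.
apply/bounded_funE; exists (`|a| + `|b|) => x /=.
have /andP[af fb] := clip_itv a b (f x) ab.
rewrite ler_norml; apply/andP; split.
  apply: le_trans af; rewrite opprD lerBlDr ler_wpDr//.
  by rewrite lerNl ler_normr lexx orbT.
by apply: (le_trans fb); rewrite ler_wpDl// ler_norm.
Qed.

Section Tietze.
Context {X : topologicalType} (Y : set X).
Hypothesis sepYX : forall A B : set Y, B1_completely_separated R A B ->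
  B1_completely_separated R (set_val @` A) (set_val @` B).

Lemma separated_tietze_step (r : R) (f : Y -> R) :
  0 < r -> baire_one R (set_type Y) f -> (forall y, `|f y| <= r) ->
  exists g : X -> R, [/\ baire_one R X g, forall x, `|g x| <= r / 3 &
    forall y, `|f y - g (set_val y)| <= 2 / 3 * r].
Proof.
move=> r0 bf fr; have r3 : - (r / 3) <= r / 3 by lra.
have [|h [a [b [[bh _] ab hA hB hab]]]] :=
  sepYX [set y | f y <= - (r / 3)] [set y | r / 3 <= f y].
  exists (clip (- (r / 3)) (r / 3) \o f), (- (r / 3)), (r / 3); split.
  - exact: bounded_baire_one_clip.
  - by lra.
  - by move=> y /=; exact: clip_le.
  - by move=> y /=; exact: clip_ge.
  - by move=> y; exact: clip_itv.
have ba : 0 < b - a by lra.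
(* The affine map carrying [a] to [- (r / 3)] and [b] to [r / 3]. *)
pose phi t := (t - a) / (b - a) * (2 / 3 * r) - r / 3.
have phi_itv t : a <= t <= b -> `|phi t| <= r / 3.
  move=> /andP[at_ tb]; have q0 : 0 <= (t - a) / (b - a).
    by rewrite divr_ge0 ?(ltW ba)// subr_ge0.
  have q1 : (t - a) / (b - a) <= 1 by rewrite ler_pdivrMr// mul1r lerD2r.
  rewrite ler_norml /phi; move: q0 q1; set q := (t - a) / (b - a) => q0 q1.
  have := mulr_ge0 q0 (ltW r0).
  have : q * r <= 1 * r by rewrite ler_pM2r.
  by rewrite (mulrCA q (2 / 3)); lra.
exists (phi \o h); split.
- apply: baire_one_comp bh => t; apply: cvgB; last exact: cvg_cst.
  apply: cvgMr_tmp; apply: cvgMr_tmp; apply: cvgB; last exact: cvg_cst.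
  exact: cvg_id.
- by move=> x; exact: phi_itv.
- move=> y /=; have := fr y; have := phi_itv _ (hab (set_val y)).
  (* In the two outer cases [phi \o h] equals the endpoint [- (r / 3)] or [r / 3] nearest to [f y];
     in the middle case both values lie within [r / 3] of zero. *)
  have [fl|fl] := leP (f y) (- (r / 3)).
    rewrite hA; last by exists y.
    by rewrite /phi subrr mul0r mul0r sub0r !ler_norml; lra.
  have [fg|fg] := leP (r / 3) (f y).
    rewrite hB; last by exists y.
    by rewrite /phi divff ?gt_eqF// mul1r !ler_norml; lra.
  by rewrite !ler_norml; lra.
Qed.

Lemma separated_B1star_embedded : B1star_embedded R Y.
Proof.
move=> f [bf /bounded_funE[M' fM']].
have [M M0 fM] : exists2 M, 0 < M & forall y, `|f y| <= M.
  exists (Num.max 1 M') => [|y]; first by rewrite lt_max ltr01.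
  by rewrite le_max fM' orbT.
pose r n := geometric M (2 / 3) n.
have r_gt0 n : 0 < r n by rewrite /r /= mulr_gt0// exprn_gt0.
have rS n : r n.+1 = 2 / 3 * r n by rewrite /r /= mulrCA exprS.
have q1 : `|2 / 3| < 1 :> R by rewrite gtr0_norm//; lra.
(* The hypotheses on the remainder sit inside the existential, so that choice yields a total [S]
   before the remainders are defined by recursion; the zero function is the default where they
   fail. *)
have /choice[S SP] (nF : nat * (Y -> R)) : exists g : X -> R,
    baire_one R (set_type Y) nF.2 -> (forall y, `|nF.2 y| <= r nF.1) ->
    [/\ baire_one R X g, forall x, `|g x| <= r nF.1 / 3 &
      forall y, `|nF.2 y - g (set_val y)| <= r nF.1.+1].
  have [[bF Fr]|nbF] :=
      pselect (baire_one R (set_type Y) nF.2 /\ forall y, `|nF.2 y| <= r nF.1).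
    have [g gP] := separated_tietze_step _ _ (r_gt0 nF.1) bF Fr.
    by exists g => _ _; rewrite rS.
  by exists (cst 0) => ? ?; exfalso; apply: nbF.
pose F := fix F n := if n is m.+1 then F m \- (S (m, F m) \o set_val) else f.
pose g n := S (n, F n).
have FP n : baire_one R (set_type Y) (F n) /\ forall y, `|F n y| <= r n.
  elim: n => [|n [bF Fr]]; first by split=> // y; rewrite /r /= expr0 mulr1.
  have [bg _ Fg] := SP (n, F n) bF Fr; split; last exact: Fg.
  apply: baire_oneB bF _; apply: baire_one_pullback bg.
  exact: initial_continuous.
have gP n : baire_one R X (g n) /\ forall x, `|g n x| <= r n / 3.
  by have [bF Fr] := FP n; have [] := SP (n, F n) bF Fr.
have cvg_r : cvgn (series (fun n => r n / 3)).
  rewrite (_ : (fun n => _) = geometric (M / 3) (2 / 3)).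
    exact: is_cvg_geometric_series.
  by apply/funext => n; rewrite /r /= mulrAC.
pose G x := limn (series (g ^~ x)).
have bG : baire_one R X G.
  by apply: (baire_one_series g (fun n => r n / 3)) => // n; have [] := gP n.
have GE y : G (set_val y) = f y.
  (* The sum telescopes, since each [g n] restricted to [Y] is [F n] minus [F n.+1]. *)
  have FE n : series (g ^~ (set_val y)) n = f y - F n y.
    elim: n => [|n IH]; first by rewrite seriesEnat /= big_geq// subrr.
    by rewrite seriesSr IH /= opprB addrCA addrC.
  apply/cvg_lim => //; apply/cvgrPdist_le => e e0.
  have /cvgrPdist_le/(_ _ e0) := cvg_geometric M q1.
  apply: filterS => n; rewrite sub0r normrN FE subKr => /(le_trans _); apply.
  by apply: le_trans (ler_norm _); have [_] := FP n.
(* Truncating at [M] makes the extension bounded and leaves it unchanged on [Y], where it equals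
   [f]. *)
exists (clip (- M) M \o G); first by apply: bounded_baire_one_clip => //; lra.
by apply/funext => y /=; rewrite GE clip_id// -ler_norml.
Qed.

End Tietze.

Lemma B1star_embedded_separated (X : topologicalType) (Y : set X) :
  B1star_embedded R Y -> forall A B : set Y, B1_completely_separated R A B ->
  B1_completely_separated R (set_val @` A) (set_val @` B).
Proof.
move=> embY A B [f [r [s [bf rs fA fB frs]]]]; have [g [bg _] gf] := embY f bf.
have gE y : g (set_val y) = f y by rewrite -gf.
(* Off [Y] the extension [g] may leave the interval from [r] to [s], hence the truncation. *)
exists (clip r s \o g), r, s; split => //.
- exact/bounded_baire_one_clip/bg/ltW.
- by move=> _ [y Ay <-] /=; rewrite gE clip_id// fA.
- by move=> _ [y By <-] /=; rewrite gE clip_id// fB.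
- by move=> x; exact/clip_itv/ltW.
Qed.

End BaireOneTheory.

Theorem theorem5p4 (R : realType) (X : topologicalType) (Y : set X) :
  B1star_embedded R Y <->
  (forall A B : set Y,
     B1_completely_separated R A B ->
     B1_completely_separated R (set_val @` A) (set_val @` B)).
Proof.
split; first exact: B1star_embedded_separated.
exact: separated_B1star_embedded.
Qed.
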